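(* Let $u_1<u_2<u_3<\cdots$ be the increasing enumeration of the unsums of upper Wythoff numbers, and let $g_n=u_{n+1}-u_n$ for $n\ge 1$ be the sequence of gaps, regarded as an infinite word $g_1g_2g_3\cdots$ over the positive integers. Then there are finite words $W_1,W_2,W_3,\ldots$ over the alphabet $\{3,5\}$, with $W_1=3$, $W_2=33$, $W_3=353$, such that $$g_1g_2g_3\cdots = 1111122121\; 2W_1\,2W_1\,2W_2\,2W_2\,2W_3\,2W_3\,2W_4\,2W_4\cdots$$ and the following hold. (i) Every $W_i$ is a palindrome of length $|W_i|=F_{i+1}$. (ii) For every $i\ge 1$, the sum of the digits of $W_i$ plus $2$ equals $F_{i+4}$. (iii) For every $n\ge 3$, the words $W_{n+1}$ and $W_n$ agree on their first $\lceil |W_{n+1}|/2\rceil$ letters. (iv) The words $W_n$ converge (letter by letter) to the infinite word $3\,\mathbf{F}'$, where $\mathbf{F}'$ is obtained from the Fibonacci word $\mathbf{F}$ by replacing each $a$ by $5$ and each $b$ by $3$.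
   Context: The Fibonacci numbers are $F_0=0$, $F_1=1$, $F_{n+2}=F_{n+1}+F_n$. The Fibonacci word $\mathbf{F}=abaababaabaab\cdots$ is the infinite word beginning with $a$ that is fixed by the substitution $a\mapsto ab$, $b\mapsto a$. The upper Wythoff numbers $2,5,7,10,13,15,18,20,23,26,28,31,\ldots$ are the positions of the letter $b$ in $\mathbf{F}$, with positions counted starting from $1$. An unsum is a positive integer that is not the sum of two distinct upper Wythoff numbers (OEIS A260317; it starts $1,2,3,4,5,6,8,10,11,13,14,16,19,\ldots$); the sequence of gaps is OEIS A260311. A palindrome is a finite word equal to its reversal. *)

(* Defs.v *)
From mathcomp Require Import all_boot.

Set Implicit Arguments.
Unset Strict Implicit.
Unset Printing Implicit Defensive.

Fixpoint fib (n : nat) : nat :=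
  match n with
  | 0 => 0
  | 1 => 1
  | (n2.+1 as n1).+1 => fib n1 + fib n2
  end.

(* Infinite words are functions [nat -> A] whose indices start at 0: the n-th
   letter of [w] (counting from 1) is [w n.-1]. *)

Definition prefix_of (A : Type) (s : seq A) (w : nat -> A) : Prop :=
  s = mkseq w (size s).

Inductive letter := La | Lb.

Definition fib_subst (x : letter) : seq letter :=
  match x with La => [:: La; Lb] | Lb => [:: La] end.

Definition subst_word (A B : Type) (h : A -> seq B) (s : seq A) : seq B :=
  flatten (map h s).

(* [v] is the image of the infinite word [w] under [h].  This determines [v]
   when [h] maps no letter to the empty word. *)
Definition is_subst_image (A B : Type) (h : A -> seq B) (w : nat -> A)
    (v : nat -> B) : Prop :=
  forall n, prefix_of (subst_word h (mkseq w n)) v.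

Definition is_fibonacci_word (w : nat -> letter) : Prop :=
  w 0 = La /\ is_subst_image fib_subst w w.

Definition upper_wythoff (w : nat -> letter) (m : nat) : Prop :=
  0 < m /\ w m.-1 = Lb.

Definition unsum (w : nat -> letter) (m : nat) : Prop :=
  0 < m /\
  ~ (exists x y : nat,
       [/\ upper_wythoff w x, upper_wythoff w y, x <> y & m = x + y]).

(* [u n] is the (n+1)-st smallest element of [P]; such a [u] exists exactly
   when [P] is infinite. *)
Definition increasing_enumeration (P : nat -> Prop) (u : nat -> nat) : Prop :=
  (forall n, u n < u n.+1) /\ (forall m, P m <-> exists n, u n = m).

Definition gaps (u : nat -> nat) (n : nat) : nat := u n.+1 - u n.

(* 2 W_1 2 W_1 2 W_2 2 W_2 ... 2 W_k 2 W_k *)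
Definition doubled_blocks (W : nat -> seq nat) (k : nat) : seq nat :=
  flatten [seq (2 :: W i) ++ (2 :: W i) | i <- iota 1 k].

Definition recode (x : letter) : nat := match x with La => 5 | Lb => 3 end.

(* The infinite word c v *)
Definition cons_word (A : Type) (c : A) (v : nat -> A) (n : nat) : A :=
  if n is m.+1 then v m else c.

(* The default letter [c] of [nth] is irrelevant, since [k < size (W n)]. *)
Definition words_converge (A : Type) (c : A) (W : nat -> seq A)
    (v : nat -> A) : Prop :=
  forall k, exists N, forall n, N <= n -> k < size (W n) /\ nth c (W n) k = v k.

(* Existence and uniqueness of the Fibonacci word, and uniqueness of
   increasing enumerations *)

Definition fib_iter (n : nat) : seq letter :=
  iter n (subst_word fib_subst) [:: La].

Lemma subst_word_cat (A B : Type) (h : A -> seq B) (s t : seq A) :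
  subst_word h (s ++ t) = subst_word h s ++ subst_word h t.
Proof. by rewrite /subst_word map_cat flatten_cat. Qed.

Lemma prefix_of_catl (A : Type) (s t : seq A) (w : nat -> A) :
  prefix_of (s ++ t) w -> prefix_of s w.
Proof.
rewrite /prefix_of size_cat /mkseq iotaD map_cat => /(congr1 (take (size s))).
by rewrite !take_cat size_map size_iota !ltnn !subnn !take0 !cats0.
Qed.

Lemma prefix_of_nth (A : Type) (c : A) (s : seq A) (w : nat -> A) (k : nat) :
  prefix_of s w -> k < size s -> w k = nth c s k.
Proof. by move=> ->; rewrite size_mkseq => lt_k; rewrite nth_mkseq. Qed.

Lemma fib_iter_cat1 n : exists t, fib_iter n.+1 = fib_iter n ++ t.
Proof.
elim: n => [|n [t IHn]]; first by exists [:: Lb].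
by exists (subst_word fib_subst t); rewrite /= -subst_word_cat -IHn.
Qed.

Lemma fib_iter_cat m n : m <= n -> exists t, fib_iter n = fib_iter m ++ t.
Proof.
move/subnK <-; elim: (n - m) => [|d [t IHd]]; first by exists [::]; rewrite cats0.
have [t' Et'] := fib_iter_cat1 (d + m); exists (t ++ t').
by rewrite addSn Et' IHd catA.
Qed.

Lemma size_subst_word_ge s : size s <= size (subst_word fib_subst s).
Proof. by elim: s => [|[] s IHs] //=; rewrite ltnS // ltnW. Qed.

Lemma size_fib_iter n : n < size (fib_iter n).
Proof.
elim: n => // n IHn; have [t Et] := fib_iter_cat (leq0n n).
rewrite Et /= in IHn; rewrite /= Et /= ltnS; apply: leq_trans IHn _.
by rewrite ltnS; exact: size_subst_word_ge.
Qed.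

Definition fibonacci_word (n : nat) : letter := nth La (fib_iter n) n.

Lemma fib_iter_prefix n : prefix_of (fib_iter n) fibonacci_word.
Proof.
apply: (@eq_from_nth _ La) => [|i lt_i]; first by rewrite size_mkseq.
rewrite nth_mkseq // /fibonacci_word.
case: (leqP i n) => [|/ltnW] /fib_iter_cat[t ->]; rewrite nth_cat ?lt_i //.
by rewrite size_fib_iter.
Qed.

Lemma fibonacci_wordP : is_fibonacci_word fibonacci_word.
Proof.
split=> // n; have En := fib_iter_prefix n.
apply: (@prefix_of_catl _ _
  (subst_word fib_subst (drop n (fib_iter n)))).
rewrite -subst_word_cat.
suff -> : mkseq fibonacci_word n = take n (fib_iter n).
  by rewrite cat_take_drop; exact: (fib_iter_prefix n.+1).
by rewrite En /mkseq -map_take take_iota (minn_idPl (ltnW (size_fib_iter n))).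
Qed.

Lemma fibonacci_word_uniq w : is_fibonacci_word w -> w =1 fibonacci_word.
Proof.
case=> w0 fix_w n; suff pre_w : prefix_of (fib_iter n) w.
  exact: prefix_of_nth pre_w (size_fib_iter n).
elim: n => [|n IHn]; first by rewrite /prefix_of /= /mkseq /= w0.
by rewrite /= IHn; exact: fix_w.
Qed.

Lemma increasing_enumeration_uniq P u v :
  increasing_enumeration P u -> increasing_enumeration P v -> u =1 v.
Proof.
move=> [incu Pu] [incv Pv].
have mono (f : nat -> nat) : (forall n, f n < f n.+1) ->
    {mono f : m n / m <= n}.
  by move=> inc; apply: leq_mono; exact: (homo_ltn ltn_trans inc).
have le_uv (f g : nat -> nat) : (forall n, f n < f n.+1) ->
    (forall n, g n < g n.+1) -> (forall n, exists k, g k = f n) ->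
    forall n, g n <= f n.
  move=> incf incg sub; elim=> [|n IHn].
    by have [k <-] := sub 0; rewrite (mono g).
  have [k Ek] := sub n.+1; rewrite -Ek (mono g incg) ltnNge -(mono g incg) Ek.
  by rewrite -ltnNge; apply: leq_ltn_trans IHn (incf n).
move=> n; apply/eqP; rewrite eqn_leq !le_uv // => k.
  by apply/Pv/Pu; exists k.
by apply/Pu/Pv; exists k.
Qed.

(* Main.v *)
From Stdlib Require Import Reals ZArith Lra Lia.
Require Import Defs.
From mathcomp Require Import all_boot.
From mathcomp Require Import zify.

(* Let alpha = (sqrt 5 - 1) / 2.  The Fibonacci word codes the rotation by alpha:
   m is upper Wythoff iff m alpha mod 1 lies in (0, alpha^2).  Hence m with
   m alpha mod 1 in (2 alpha^2, 1) is an unsum; these m are exactly the numbers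
   3 + (sum of the first k letters of F'), k >= 0.  Any other m is an unsum only if
   every candidate summand close to an endpoint of (0, 2 alpha^2) fails; since the
   best approximations to multiples of alpha are Fibonacci numbers, this happens
   only for m = F_j, 2 F_j (j odd) and m = F_j - 2, 2 F_j - 2 (j even).  From
   N - 2 to N - 2 + F_{i+4}, where N = 2 F_{i+5} or N = F_{i+7}, the unsums form
   one block 2 W_i, because translation by N almost fixes the rotation; W_i is 3,
   then the first F_{i+1} - 2 letters of F', then 3, and is a palindrome by the
   symmetry x -> F_{i+1} - 1 - x of the rotation. *)

Arguments fib : simpl nomatch.

(** * Growth of the Fibonacci numbers *)

Lemma fibSS n : fib n.+2 = fib n.+1 + fib n. Proof. by []. Qed.

Lemma fib_gt0 n : 0 < fib n.+1.
Proof. by elim: n => // n IHn; rewrite fibSS ltn_addr. Qed.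

Lemma fib_leS n : fib n <= fib n.+1.
Proof. by case: n => // n; rewrite [fib n.+2]fibSS leq_addr. Qed.

Lemma fib_mono m n : m <= n -> fib m <= fib n.
Proof. by apply: (homo_leq leqnn leq_trans) => k; exact: fib_leS. Qed.

Lemma fib_ge n : n <= (fib n).+1.
Proof.
elim/ltn_ind: n => -[|[|[|[|n]]]] // IHn.
have := IHn n.+3 (ltnSn _); have := fib_gt0 n.+1.
rewrite (fibSS n.+2); lia.
Qed.

(** Steps of two keep the parity of the index, which decides the sign of the error of a Fibonacci
    number. *)
Lemma fib_bracket i n :
  0 < i -> fib i <= n -> exists t, fib (i + t.*2) <= n < fib (i + t.*2).+2.
Proof.
move=> i_gt0 le_in.
have ex0 : exists t, fib (i + t.*2) <= n by exists 0; rewrite addn0.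
have bnd t : fib (i + t.*2) <= n -> t <= n by have := fib_ge (i + t.*2); lia.
case: (ex_maxnP ex0 bnd) => t le_tn max_t; exists t; rewrite le_tn ltnNge.
apply/negP => le_n; have := max_t t.+1.
by rewrite doubleS !addnS => /(_ le_n); rewrite ltnn.
Qed.

(** * Letter counts under the substitution *)

Definition is_La (x : letter) : bool := if x is La then true else false.

Definition count_La (F : nat -> letter) (k : nat) : nat :=
  count is_La (mkseq F k).

Lemma count_LaS F k : count_La F k.+1 = count_La F k + is_La (F k).
Proof. by rewrite /count_La mkseqS -cats1 count_cat /= addn0. Qed.

Lemma size_subst_fib s :
  size (subst_word fib_subst s) = size s + count is_La s.
Proof. by elim: s => [|[] s IHs] //; move: IHs; rewrite /subst_word /=; lia. Qed.

Lemma count_subst_fib s : count is_La (subst_word fib_subst s) = size s.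
Proof. by elim: s => [|[] s IHs] //; move: IHs; rewrite /subst_word /=; lia. Qed.

(** Each letter has exactly one a in its image, so the image of the first [k] letters is a prefix
    with [k] letters a. *)
Lemma count_La_image F k :
  is_fibonacci_word F -> count_La F (k + count_La F k) = k.
Proof.
case=> _ /(_ k) /(congr1 (count is_La)).
by rewrite count_subst_fib size_subst_fib size_mkseq.
Qed.

Lemma fib_word_image F k :
  is_fibonacci_word F -> F (k + count_La F k) = La.
Proof.
case=> _ /(_ k.+1); rewrite mkseqS -cats1 subst_word_cat => pre.
have E : size (subst_word fib_subst (mkseq F k)) = k + count_La F k.
  by rewrite size_subst_fib size_mkseq.
rewrite (prefix_of_nth La pre) -E; last first.
  by rewrite size_cat /subst_word /=; case: (F k) => /=; lia.
by rewrite nth_cat ltnn subnn /subst_word /=; case: (F k).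
Qed.

Lemma fib_word_cover F n : exists k,
  n = k + count_La F k \/ n = (k + count_La F k).+1.
Proof.
elim: n => [|n [k IHn]]; first by exists 0; left.
case: IHn => En; first by exists k; right; rewrite En.
by exists k.+1; rewrite count_LaS; case: is_La => /=; [left|right]; lia.
Qed.

Lemma count_La_gt0 F k : is_fibonacci_word F -> 0 < k -> 0 < count_La F k.
Proof.
case=> F0 _; case: k => // k _.
by elim: k => [|k IHk]; rewrite count_LaS ?F0 /=; lia.
Qed.

Delimit Scope R_scope with real.
Local Open Scope R_scope.

(** * Approximation by the golden ratio *)

Definition alpha : R := (sqrt 5 - 1) / 2.

Lemma alpha_sqr : alpha * alpha = 1 - alpha.
Proof.
have s5 : sqrt 5 * sqrt 5 = 5 by apply: sqrt_sqrt; lra.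
rewrite /alpha; nra.
Qed.

Lemma alpha_bounds : 0.618 < alpha < 0.619.
Proof.
have s5 : sqrt 5 * sqrt 5 = 5 by apply: sqrt_sqrt; lra.
have s0 : 0 <= sqrt 5 by exact: sqrt_pos.
rewrite /alpha; nra.
Qed.

Lemma alpha_powSS n : alpha ^ n.+2 = alpha ^ n - alpha ^ n.+1.
Proof. by rewrite /= -Rmult_assoc alpha_sqr; ring. Qed.

Lemma alpha_pow2 : alpha ^ 2 = 1 - alpha.
Proof. by rewrite alpha_powSS /=; ring. Qed.

Lemma alpha_pow3 : alpha ^ 3 = 2 * alpha - 1.
Proof. by rewrite alpha_powSS alpha_pow2 /=; ring. Qed.

Lemma alpha_pow_gt0 n : 0 < alpha ^ n.
Proof. by apply: pow_lt; have := alpha_bounds; lra. Qed.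

Lemma alpha_powS_bounds n :
  0.618 * alpha ^ n < alpha ^ n.+1 < 0.619 * alpha ^ n.
Proof. by have := alpha_bounds; have := alpha_pow_gt0 n; rewrite /=; nra. Qed.

Lemma alpha_pow_le m n : (m <= n)%N -> alpha ^ n <= alpha ^ m.
Proof.
move/subnK <-; elim: (n - m)%N => [|d IHd]; first by rewrite add0n; lra.
rewrite addSn; have := alpha_powS_bounds (d + m); have := alpha_pow_gt0 (d + m).
lra.
Qed.

Lemma pow_m1S n : (-1) ^ n.+1 = - (-1) ^ n. Proof. by rewrite /=; ring. Qed.

Lemma pow_m1 n : (-1) ^ n = if odd n then -1 else 1.
Proof. by elim: n => // n IHn; rewrite pow_m1S IHn oddS; case: odd => /=; lra. Qed.

Lemma IZR_lt1 z : -1 < IZR z < 1 -> z = 0%Z.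
Proof.
case=> /lt_IZR gt_z /lt_IZR; lia.
Qed.

(** Coordinates on $\mathbb{Z}[\alpha]$; a small positive value means that $x\alpha$ lies just below
    the integer [k]. *)
Definition err (x k : Z) : R := IZR k - IZR x * alpha.

Lemma errD x y k l : err (x + y) (k + l) = err x k + err y l.
Proof. by rewrite /err !plus_IZR; ring. Qed.

Lemma errB x y k l : err (x - y) (k - l) = err x k - err y l.
Proof. by rewrite /err !minus_IZR; ring. Qed.

Lemma errk x k l : err x l = err x k + IZR (l - k).
Proof. by rewrite /err minus_IZR; ring. Qed.

(* Multiplication by [- (1 + alpha)] on Z[alpha]. *)
Lemma err_flip x k : err k (x - k) = - (1 + alpha) * err x k.
Proof.
suff : err k (x - k) + (1 + alpha) * err x k = 0 by lra.
rewrite /err minus_IZR.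
transitivity (IZR x * (1 - alpha - alpha * alpha)); first by ring.
by rewrite alpha_sqr; ring.
Qed.

(** As $1+\alpha=1/\alpha$, [err_flip] stretches $(0,\alpha b)$ to $(0,b)$ and reverses the sign. *)
Lemma flip_bounds s e b :
  0 < s * e < alpha * b -> 0 < - s * (- (1 + alpha) * e) < b.
Proof.
have -> : - s * (- (1 + alpha) * e) = (1 + alpha) * (s * e) by ring.
have bE : b = (1 + alpha) * (alpha * b).
  transitivity (b * (alpha + alpha * alpha)); last by ring.
  by rewrite alpha_sqr; ring.
by have := alpha_bounds; move: (s * e) (alpha * b) bE => t c ->; nra.
Qed.

(** Irrationality of $\alpha$ by descent: a solution with $x>0$ yields the solution $(k,x-k)$ with
    $0<k<x$. *)
Lemma err_eq0 x k : err x k = 0 -> x = 0%Z.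
Proof.
suff pos n : forall x k, (Z.of_nat n > x)%Z -> (0 <= x)%Z -> err x k = 0 -> x = 0%Z.
  move=> e0; case: (Z_le_gt_dec 0 x) => [x0|x0].
    by apply: (pos (Z.to_nat x).+1 x k _ x0 e0); lia.
  suff : (- x = 0)%Z by lia.
  apply: (pos (Z.to_nat (- x)).+1 _ (- k)%Z); try lia.
  by move: e0; rewrite /err !opp_IZR; lra.
elim: n => [|n IHn] {}x {}k ltx x0 e0; first by lia.
case: (Z.eq_dec x 0) => // xN0.
have : IZR x > 0 by apply: (IZR_lt 0); lia.
have := alpha_bounds; move: (e0); rewrite {1}/err => e1 ab xp.
have k0 : (0 < k)%Z by apply: lt_IZR; nra.
have kx : (k < x)%Z by apply: lt_IZR; nra.
have : k = 0%Z by apply: (IHn k (x - k)%Z); [lia|lia|rewrite err_flip e0; ring].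
by lia.
Qed.

Notation fibZ n := (Z.of_nat (fib n)).

(** [err_flip] takes each consecutive pair to the previous one, so the errors are geometric of ratio
    $-\alpha$. *)
Lemma err_fib i : err (fibZ i.+2) (fibZ i.+1) = (-1) ^ i * alpha ^ i.+2.
Proof.
elim: i => [|i IHi].
  by rewrite /err /=; have := alpha_sqr; lra.
have E : err (fibZ i.+2) (fibZ i.+1) = - (1 + alpha) * err (fibZ i.+3) (fibZ i.+2).
  by rewrite -err_flip; congr err; rewrite (fibSS i.+1); lia.
have -> : err (fibZ i.+3) (fibZ i.+2) = - alpha * err (fibZ i.+2) (fibZ i.+1).
  rewrite E; set e := err _ _.
  transitivity ((alpha * alpha + alpha) * e); last by ring.
  by rewrite alpha_sqr; ring.
rewrite IHi pow_m1S; have -> : alpha ^ i.+3 = alpha * alpha ^ i.+2 by [].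
by ring.
Qed.

Lemma err_fib_abs i : Rabs (err (fibZ i.+2) (fibZ i.+1)) = alpha ^ i.+2.
Proof.
rewrite err_fib Rabs_mult pow_1_abs Rmult_1_l Rabs_pos_eq //.
exact/Rlt_le/alpha_pow_gt0.
Qed.

(** For index $i+2$, one flip makes [k] an instance at $i+1$ and a second makes [x - k] an instance
    at $i$; the two lower bounds add up by the Fibonacci recurrence. *)
Lemma best_approx i x k :
  (0 < x)%Z -> 0 < (-1) ^ i * err x k < alpha ^ i -> (fibZ i.+2 <= x)%Z.
Proof.
elim/ltn_ind: i x k => -[|[|i]] IHi x k x0.
- by rewrite /=; lia.
- rewrite /= => e; case: (Z.eq_dec x 1) => [x1|]; last by lia.
  move: e; rewrite x1 /err => e; have ab := alpha_bounds.
  have k1 : (k < 1)%Z by apply: lt_IZR; lra.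
  have k0 : (0 < k)%Z by apply: lt_IZR; lra.
  by lia.
move=> e; have := alpha_bounds => ab.
have xge1 : 1 <= IZR x by apply: (IZR_le 1); lia.
have le2 : alpha ^ i.+2 <= alpha ^ 2 by exact: alpha_pow_le.
have e2 : - (1 - alpha) < err x k < 1 - alpha.
  by move: e le2; rewrite pow_m1 alpha_pow2; case: odd; lra.
have k0 : (0 < k)%Z by apply: lt_IZR; move: e2; rewrite /err; nra.
have xk0 : (0 < x - k)%Z.
  by apply: lt_IZR; rewrite minus_IZR; move: e2; rewrite /err; nra.
have e3 : 0 < (-1) ^ i.+1 * err k (x - k) < alpha ^ i.+1.
  rewrite err_flip -[(-1) ^ i.+1]Ropp_involutive -pow_m1S.
  exact: flip_bounds.
have e4 : 0 < (-1) ^ i * err (x - k) (k - (x - k)) < alpha ^ i.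
  rewrite err_flip -[(-1) ^ i]Ropp_involutive -pow_m1S.
  exact: flip_bounds.
have := IHi _ (ltnSn _) _ _ k0 e3; have := IHi _ (leqnSn _) _ _ xk0 e4.
rewrite (fibSS i.+2); lia.
Qed.

(** An error of sign $(-1)^i$ falls under [best_approx] at $i$, one of the opposite sign at $i+1$;
    the latter fixes the exponent. *)
Lemma best_approx_abs i x k :
  (0 < x)%Z -> Rabs (err x k) < alpha ^ i.+1 -> (fibZ i.+2 <= x)%Z.
Proof.
move=> x0 /Rabs_def2 [e1 e2].
have eN0 : err x k <> 0 by move/err_eq0; lia.
have [|] : 0 < (-1) ^ i * err x k \/ 0 < (-1) ^ i.+1 * err x k.
- rewrite !pow_m1 oddS; case: odd => /=; lra.
- move=> e; apply: (@best_approx _ _ k) => //; split=> //.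
  by have := alpha_powS_bounds i; have := alpha_pow_gt0 i; move: e;
     rewrite pow_m1; case: odd; lra.
- move=> e; suff : (fibZ i.+3 <= x)%Z by have := fib_leS i.+2; lia.
  apply: (@best_approx _ _ k) => //; split=> //.
  by move: e; rewrite pow_m1; case: odd; lra.
Qed.

(** * The Fibonacci word as a rotation *)

Lemma errE x k : err x k = IZR k - IZR x * alpha. Proof. by []. Qed.

Lemma err_unflip x k : err (x + k) x = - alpha * err x k.
Proof.
rewrite /err plus_IZR.
transitivity (- alpha * (IZR k - IZR x * alpha)
              + IZR x * (1 - alpha - alpha * alpha)); first by ring.
by rewrite alpha_sqr; ring.
Qed.

Ltac push_IZR :=
  rewrite ?(plus_IZR, minus_IZR, mult_IZR, opp_IZR, succ_IZR).

(** Thus the first [k] letters contain $\lfloor(k+1)\alpha\rfloor$ letters a. Passing from a prefix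
    to its image is [err_unflip] up to a translation, which keeps the error in $(-1,0)$. *)
Lemma count_La_err F k : is_fibonacci_word F ->
  -1 < err (Z.of_nat k.+1) (Z.of_nat (count_La F k)) < 0.
Proof.
move=> hF; have [F0 _] := hF; have ab := alpha_bounds.
elim/ltn_ind: k => n IHn.
have [k En] := fib_word_cover F n.
case: (posnP k) => [k0|k_gt0].
  by case: En; rewrite k0 => ->; rewrite ?count_LaS ?F0 /err /=; lra.
have lt_kn : (k < n)%N by have := count_La_gt0 _ k hF k_gt0; lia.
have := IHn _ lt_kn; case: En => ->.
(* The new error is $-\alpha e-1$ here and $-\alpha e-\alpha$ in the other case. *)
- rewrite (count_La_image _ k hF); set c := count_La F k.
  have -> : Z.of_nat (k + c).+1 = (Z.of_nat k.+1 + Z.of_nat c)%Z by lia.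
  rewrite (errk _ (Z.of_nat k.+1) (Z.of_nat k)) err_unflip.
  have -> : (Z.of_nat k - Z.of_nat k.+1 = -1)%Z by lia.
  by move: (err _ _) => e; nra.
- rewrite count_LaS (fib_word_image _ k hF) (count_La_image _ k hF).
  set c := count_La F k.
  have -> : Z.of_nat (k + c).+2 = (Z.of_nat k.+1 + Z.of_nat c + 1)%Z by lia.
  have -> : Z.of_nat (k + is_La La) = (Z.of_nat k.+1 + 0)%Z by rewrite /=; lia.
  by rewrite errD err_unflip; move: (err _ (Z.of_nat c)) => e; rewrite /err; nra.
Qed.

(** The letter is b exactly when $\lfloor(k+1)\alpha\rfloor=\lfloor(k+2)\alpha\rfloor$. *)
Lemma fib_word_Lb F k : is_fibonacci_word F ->
  F k = Lb <-> exists q, 0 < -1 * err (Z.of_nat k.+1) q < alpha ^ 2.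
Proof.
move=> hF; have := count_La_err _ k hF; have := count_La_err _ k.+1 hF.
rewrite count_LaS; have ab := alpha_bounds; rewrite alpha_pow2.
have E q : err (Z.of_nat k.+2) q = err (Z.of_nat k.+1) q - alpha.
  have -> : Z.of_nat k.+2 = (Z.of_nat k.+1 + 1)%Z by lia.
  by rewrite /err; push_IZR; ring.
rewrite E; case: (F k) => [e2 e1|]; last first.
  by rewrite /= addn0 => e2 e1; split=> // _; exists (Z.of_nat (count_La F k)); lra.
split=> // -[q eq].
suff : (q - Z.of_nat (count_La F k) = 0)%Z.
  move=> q0; have Eq : q = Z.of_nat (count_La F k) by lia.
  by move: e2 eq; rewrite Eq /err Nat2Z.inj_add plus_IZR /=; lra.
apply: IZR_lt1; rewrite minus_IZR; move: e2 eq e1.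
by rewrite /err Nat2Z.inj_add plus_IZR /=; lra.
Qed.

(** [err_unflip] applied three times. *)
Lemma err_cube x k : err (3 * x + 2 * k) (2 * x + k) = - alpha ^ 3 * err x k.
Proof.
rewrite alpha_pow3 /err; push_IZR.
transitivity (- (2 * alpha - 1) * (IZR k - IZR x * alpha)
              + 2 * IZR x * (1 - alpha - alpha * alpha)); last first.
  by rewrite alpha_sqr; ring.
by ring.
Qed.

(* [near0 m] says that m alpha mod 1 is in (2 alpha^2, 1). *)
Definition near0 (n : Z) : Prop := exists k, 0 < err n k < alpha ^ 3.

(** Division by $-\alpha^3$ maps $(0,\alpha^3)$ onto $(-1,0)$, where $x=k+1$ has the single partner
    [count_La F k]. *)
Lemma near0_fib_word F m : is_fibonacci_word F -> (0 < m)%N ->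
  near0 (Z.of_nat m) <-> exists k, m = (3 + 3 * k + 2 * count_La F k)%N.
Proof.
move=> hF m0; have ab := alpha_bounds; have a3 := alpha_pow_gt0 3; split.
- case=> K; set x := (2 * K - Z.of_nat m)%Z; set c := (2 * Z.of_nat m - 3 * K)%Z.
  have Em : Z.of_nat m = (3 * x + 2 * c)%Z by rewrite /x /c; lia.
  have -> : K = (2 * x + c)%Z by rewrite /x /c; lia.
  rewrite Em err_cube => e.
  have {}e : -1 < err x c < 0 by move: a3 e; move: (err _ _) (alpha ^ 3) => u v; nra.
  have x0 : (0 < x)%Z.
    case: (Z_lt_ge_dec 0 x) => // xle0.
    have : IZR x <= 0 by apply: IZR_le; lia.
    move: e; rewrite /err => e xle.
    have : (c < 0)%Z by apply: lt_IZR; nra.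
    by lia.
  have xgt0 : 1 <= IZR x by apply: (IZR_le 1); lia.
  have c0 : (-1 < c)%Z by apply: lt_IZR; move: e; rewrite /err; nra.
  exists (Z.to_nat x).-1; set k := (Z.to_nat x).-1.
  have Ex : x = Z.of_nat k.+1 by rewrite /k; lia.
  suff : (c - Z.of_nat (count_La F k) = 0)%Z by lia.
  apply: IZR_lt1; have := count_La_err F k hF; move: e.
  by rewrite -Ex /err minus_IZR; lra.
- case=> k Em; exists (2 * Z.of_nat k.+1 + Z.of_nat (count_La F k))%Z.
  have -> : Z.of_nat m = (3 * Z.of_nat k.+1 + 2 * Z.of_nat (count_La F k))%Z.
    by lia.
  rewrite err_cube; have := count_La_err F k hF; move: a3.
  by move: (err _ _) (alpha ^ 3) => u v; nra.
Qed.

(** * Sums of two numbers from one arc of the rotation *)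

(* [near (-1)] is the upper Wythoff condition; [near 1] is its mirror image, used
   for [p + 1] to treat both endpoints of (0, 2 alpha^2) at once. *)
Definition near (s : R) (p : Z) : Prop := exists k, 0 < s * err p k < alpha ^ 2.

Definition near_sum (s : R) (n : Z) : Prop := exists p q : Z,
  [/\ (0 < p)%Z, (0 < q)%Z, p <> q, n = (p + q)%Z & near s p /\ near s q].

Lemma pow_m1_sqr i : (-1) ^ i * (-1) ^ i = 1.
Proof. by rewrite pow_m1; case: odd; lra. Qed.

(** The errors of [p] and [q] have one sign and total size $c\alpha^{i+2}<\alpha^i$, so
    [best_approx] gives $p,q\ge F_{i+2}$; being distinct, they add up to more than $2F_{i+2}$. *)
Lemma near_sum_fib_false i c : (0 < i)%N -> (1 <= c <= 2)%Z ->
  ~ near_sum ((-1) ^ i) (c * fibZ i.+2).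
Proof.
move=> i0 c12 [p [q [p0 q0 npq Epq [[k ek] [l el]]]]].
have ab := alpha_bounds; have a0 := alpha_pow_gt0 i.
have ai2 : alpha ^ i.+2 = (1 - alpha) * alpha ^ i.
  by rewrite -alpha_pow2 -pow_add plusE addnC addn2.
have ai : alpha ^ i <= alpha by have := alpha_pow_le _ _ i0; rewrite pow_1.
have cR : 1 <= IZR c <= 2 by split; [apply: (IZR_le 1)|apply: (IZR_le _ 2)]; lia.
set s := (-1) ^ i in ek el; have ss : s * s = 1 by exact: pow_m1_sqr.
have s1 : s = 1 \/ s = -1 by rewrite /s pow_m1; case: odd; lra.
have En : err (c * fibZ i.+2) (c * fibZ i.+1) = s * (IZR c * alpha ^ i.+2).
  transitivity (IZR c * err (fibZ i.+2) (fibZ i.+1)).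
    by rewrite /err; push_IZR; ring.
  by rewrite err_fib -/s; ring.
(* Both integers approximate the sum with [s]-signed error in $(0,2\alpha^2)$, an interval shorter
   than 1. *)
have z0 : (k + l - c * fibZ i.+1 = 0)%Z.
  apply: IZR_lt1; have : err (p + q) (k + l) = err p k + err q l by exact: errD.
  rewrite -Epq (errk _ (c * fibZ i.+1) (k + l)) En; set z := IZR (_ - _) => Ez.
  move: ek el; rewrite alpha_pow2 => ek el.
  have : 0 < IZR c * alpha ^ i.+2 <= 2 * (2 * alpha - 1).
    have -> : 2 * alpha - 1 = (1 - alpha) * alpha by have := alpha_sqr; lra.
    have : 0 < IZR c * alpha ^ i <= 2 * alpha by nra.
    by rewrite ai2; move: (alpha ^ i) => a; nra.
  by case: s1 => Es; rewrite Es in ek el Ez; lra.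
have Es : s * err p k + s * err q l = IZR c * alpha ^ i.+2.
  rewrite -Rmult_plus_distr_l -errD -Epq.
  have -> : (k + l = c * fibZ i.+1)%Z by lia.
  by rewrite En -Rmult_assoc ss; ring.
have small : IZR c * alpha ^ i.+2 < alpha ^ i.
  have : IZR c * (1 - alpha) < 1 by nra.
  by rewrite ai2; move: a0; move: (alpha ^ i) => a; nra.
have : (fibZ i.+2 <= p)%Z by apply: (@best_approx i p k) => //; rewrite -/s; lra.
have : (fibZ i.+2 <= q)%Z by apply: (@best_approx i q l) => //; rewrite -/s; lra.
nia.
Qed.

(** With $F_{i+2}\le n<F_{i+4}$ and [i] of the parity of [i0], the summands are $F_{i+2}$ and the
    rest: the error of [n] exceeds that of $F_{i+2}$, so the rest keeps the sign. *)
Lemma near_sum_intro i0 (n : Z) :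
  (0 < i0 <= 2)%N -> (0 < n)%Z -> near ((-1) ^ i0) n ->
  (forall i, (0 < i)%N -> odd i = odd i0 ->
     n <> fibZ i.+2 /\ n <> (2 * fibZ i.+2)%Z) ->
  near_sum ((-1) ^ i0) n.
Proof.
move=> i02 n0 [k ek] nfib; have ab := alpha_bounds.
have le0 : (fibZ i0.+2 <= n)%Z.
  apply: (@best_approx i0 n k) => //.
  have : alpha ^ 2 <= alpha ^ i0 by apply: alpha_pow_le; lia.
  by lra.
have /fib_bracket : (fib i0.+2 <= Z.to_nat n)%N by lia.
case=> // t; set i := (i0 + t.*2)%N; rewrite !addSn -/i => Hn.
have Ei : (-1) ^ i = (-1) ^ i0 by rewrite !pow_m1 /i oddD odd_double addbF.
have oi : odd i = odd i0 by rewrite /i oddD odd_double addbF.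
have i_gt0 : (0 < i)%N by rewrite /i; lia.
have [nf n2f] := nfib i i_gt0 oi.
set s := (-1) ^ i0 in ek Ei *.
have ss : s * s = 1 by exact: pow_m1_sqr.
have e2 : err (n - fibZ i.+2) (k - fibZ i.+1) = err n k - s * alpha ^ i.+2.
  by rewrite errB err_fib Ei.
have a2 : alpha ^ i.+2 < alpha ^ 2.
  have : alpha ^ i.+2 <= alpha ^ 3 by apply: alpha_pow_le; lia.
  by rewrite alpha_pow3 alpha_pow2; lra.
have a0 := alpha_pow_gt0 i.+2.
(* A smaller error would force $n\ge F_{i+4}$; equality, excluded next, would give $n=F_{i+2}$ by
   irrationality. *)
have ge : alpha ^ i.+2 <= s * err n k.
  case: (Rle_lt_dec (alpha ^ i.+2) (s * err n k)) => // lt.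
  suff : (fibZ i.+4 <= n)%Z by lia.
  apply: (@best_approx i.+2 n k) => //; rewrite !pow_m1S Ropp_involutive Ei.
  by lra.
have ne : alpha ^ i.+2 <> s * err n k.
  move=> E; suff : (n - fibZ i.+2 = 0)%Z by lia.
  apply: (@err_eq0 _ (k - fibZ i.+1)); rewrite e2 E -Rmult_assoc ss; ring.
exists (fibZ i.+2), (n - fibZ i.+2)%Z; split; try lia.
  by have := fib_gt0 i.+1; lia.
split.
  by exists (fibZ i.+1); rewrite err_fib Ei -Rmult_assoc ss; lra.
exists (k - fibZ i.+1)%Z; rewrite e2 Rmult_minus_distr_l -Rmult_assoc ss; lra.
Qed.

Lemma near_shift p : near (-1) p <-> near 1 (p + 1).
Proof.
have E k : err (p + 1) (k + 1) = err p k + alpha ^ 2.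
  by rewrite errD alpha_pow2 /err; ring.
split=> -[k ek].
  by exists (k + 1)%Z; rewrite E; lra.
exists (k - 1)%Z; have := E (k - 1)%Z.
by rewrite Z.sub_add; lra.
Qed.

(* [near 1 1] fails (alpha = 1 - alpha ^ 2 is an endpoint), so the shift by one
   does not lose the condition [0 < p]. *)
Lemma near_sum_shift n : near_sum (-1) n <-> near_sum 1 (n + 2).
Proof.
have near1 : ~ near 1 1.
  case=> k; rewrite alpha_pow2 /err => e; have ab := alpha_bounds.
  have : (k < 1)%Z by apply: lt_IZR; lra.
  have : (0 < k)%Z by apply: lt_IZR; lra.
  by lia.
split=> -[p [q [p0 q0 npq Epq [np nq]]]].
  by exists (p + 1)%Z, (q + 1)%Z; split; try lia; split; apply: (proj1 (near_shift _)).
have p1 : p <> 1%Z by move=> Ep; rewrite Ep in np.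
have q1 : q <> 1%Z by move=> Eq; rewrite Eq in nq.
exists (p - 1)%Z, (q - 1)%Z; split; try lia.
by split; apply/near_shift; rewrite Z.sub_add.
Qed.

(** The arcs for $m\alpha$ mod 1 are $(0,\alpha^2)$, $(\alpha^2,2\alpha^2)$ and $(2\alpha^2,1)$;
    irrationality excludes the endpoints. *)
Lemma near_trichotomy m : (0 < m)%Z ->
  [\/ near (-1) m, near 1 (m + 2) | near0 m].
Proof.
move=> m0; have ab := alpha_bounds.
pose k := (up (IZR m * alpha) - 1)%Z.
have ek : -1 < err m k <= 0.
  by rewrite /err /k minus_IZR; have := archimed (IZR m * alpha); lra.
have ne0 : err m k <> 0 by move/err_eq0; lia.
have Ea : err (m + 1) (k + 1) = err m k + (1 - alpha) by rewrite errD /err; ring.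
have Eb : err (m + 2) (k + 2) = err m k + 2 * (1 - alpha).
  by rewrite errD /err; ring.
have Ec : err m (k + 1) = err m k + 1 by rewrite /err plus_IZR; ring.
have neA : err m k + (1 - alpha) <> 0 by rewrite -Ea => /err_eq0; lia.
have neB : err m k + 2 * (1 - alpha) <> 0 by rewrite -Eb => /err_eq0; lia.
case: (Rlt_le_dec (- (1 - alpha)) (err m k)) => [e|e].
  by constructor 1; exists k; rewrite alpha_pow2; lra.
case: (Rlt_le_dec (- 2 * (1 - alpha)) (err m k)) => [e'|e'].
  by constructor 2; exists (k + 2)%Z; rewrite alpha_pow2 Eb; lra.
by constructor 3; exists (k + 1)%Z; rewrite alpha_pow3 Ec; lra.
Qed.

(** Two fractional parts in $(0,\alpha^2)$ add up to one in $(0,2\alpha^2)$, without wrapping since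
    $2\alpha^2<1$. *)
Lemma near0_not_sum m : near0 m -> ~ near_sum (-1) m.
Proof.
case=> k ek [p [q [p0 q0 npq Epq [[a ea] [b eb]]]]].
have ab := alpha_bounds; move: ek ea eb; rewrite alpha_pow2 alpha_pow3 => ek ea eb.
have Eab : err m (a + b) = err p a + err q b by rewrite Epq errD.
have : err m k = err m (a + b) + IZR (k - (a + b)) by exact: errk.
set z := (k - _)%Z => Ez.
have : (0 < z)%Z by apply: lt_IZR; lra.
have : (z < 1)%Z by apply: lt_IZR; lra.
by lia.
Qed.

(** * Classification of the unsums *)

Lemma unsumE F m : is_fibonacci_word F ->
  unsum F m <-> (0 < m)%N /\ ~ near_sum (-1) (Z.of_nat m).
Proof.
move=> hF.
have UW x : upper_wythoff F x <-> (0 < x)%N /\ near (-1) (Z.of_nat x).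
  split=> -[x0].
    by move/(fib_word_Lb F _ hF); rewrite prednK.
  by move=> nx; split=> //; apply/(fib_word_Lb F _ hF); rewrite prednK.
split=> -[m0 ns]; split=> // -[].
- move=> p [q [p0 q0 npq Em [np nq]]]; apply: ns.
  exists (Z.to_nat p), (Z.to_nat q); split; try lia.
    by apply/UW; split; [lia | rewrite Z2Nat.id //; lia].
  by apply/UW; split; [lia | rewrite Z2Nat.id //; lia].
- move=> x [y [/UW [x0 nx] /UW [y0 ny] nxy Em]]; apply: ns.
  by exists (Z.of_nat x), (Z.of_nat y); split; try lia; split.
Qed.

(** [near_sum_intro] leaves only $m=cF_j$ on the arc $(0,\alpha^2)$ and, after [near_sum_shift],
    only $m+2=cF_j$ on the next arc. *)
Lemma unsum_cases F m : is_fibonacci_word F -> unsum F m ->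
  near0 (Z.of_nat m) \/ exists j c, [/\ (3 <= j)%N, (1 <= c <= 2)%N &
    m = (c * fib j)%N \/ m.+2 = (c * fib j)%N].
Proof.
move=> hF /(unsumE F m hF) [m0 ns].
have m0Z : (0 < Z.of_nat m)%Z by lia.
have [nm|nm|] := near_trichotomy _ m0Z; [right|right|by left].
- case: (Classical_Prop.classic (exists i c, [/\ (0 < i)%N, (1 <= c <= 2)%N &
    m = (c * fib i.+2)%N])) => [[i [c [i0 c12 Em]]]|nE].
    by exists i.+2, c; split=> //; left.
  case: ns; rewrite -[- 1]pow_1; apply: near_sum_intro; rewrite ?pow_1 //.
  move=> i i0 _; split=> E; apply: nE.
    by exists i, 1%N; split=> //; lia.
  by exists i, 2%N; split=> //; lia.
- case: (Classical_Prop.classic (exists i c, [/\ (0 < i)%N, (1 <= c <= 2)%N &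
    m.+2 = (c * fib i.+2)%N])) => [[i [c [i0 c12 Em]]]|nE].
    by exists i.+2, c; split=> //; right.
  case: ns; apply/near_sum_shift.
  have E1 : (-1) ^ 2 = 1 by rewrite pow_m1.
  rewrite -E1; apply: near_sum_intro; rewrite ?E1 //; first by lia.
  move=> i i0 _; split=> E; apply: nE.
    by exists i, 1%N; split=> //; lia.
  by exists i, 2%N; split=> //; lia.
Qed.

Lemma unsum_near0 F m : is_fibonacci_word F -> (0 < m)%N ->
  near0 (Z.of_nat m) -> unsum F m.
Proof. by move=> hF m0 nm; apply/(unsumE F m hF); split=> //; exact: near0_not_sum. Qed.

Lemma err_mul_fib c i :
  err (Z.of_nat (c * fib i.+2)) (Z.of_nat (c * fib i.+1)) =
  (-1) ^ i * (IZR (Z.of_nat c) * alpha ^ i.+2).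
Proof.
transitivity (IZR (Z.of_nat c) * err (fibZ i.+2) (fibZ i.+1)).
  by rewrite /err !Nat2Z.inj_mul; push_IZR; ring.
by rewrite err_fib; ring.
Qed.

(** For $c=2$ the bound on [c] reflects $2\alpha^5<\alpha^3<2\alpha^4$. *)
Lemma mul_pow_alpha_bounds c i : (1 <= c <= 2)%N -> (c <= i)%N ->
  0 < IZR (Z.of_nat c) * alpha ^ i.+3 < alpha ^ 3.
Proof.
move=> c12 ci; have a3 := alpha_pow_gt0 3; have ai := alpha_pow_gt0 i.+3.
have [Ec|Ec] : c = 1%N \/ c = 2%N by lia.
  have := alpha_powS_bounds 3.
  have : alpha ^ i.+3 <= alpha ^ 4 by apply: alpha_pow_le; lia.
  by rewrite Ec (_ : IZR (Z.of_nat 1) = 1) //; lra.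
have := alpha_powS_bounds 4; have := alpha_powS_bounds 3.
have : alpha ^ i.+3 <= alpha ^ 5 by apply: alpha_pow_le; lia.
by rewrite Ec (_ : IZR (Z.of_nat 2) = 2) //; lra.
Qed.

(** For even [j] the error $c\alpha^j$ lies in the zone of [near0], except $2\alpha^4$; for odd [j],
    [near_sum_fib_false] applies. *)
Lemma unsum_mul_fib F c j : is_fibonacci_word F -> (3 <= j)%N ->
  (1 <= c <= 2)%N -> (c = 1%N \/ j <> 4%N) -> unsum F (c * fib j).
Proof.
move=> hF; case: j => [|[|[|j]]] // _ c12 cj.
have f0 := fib_gt0 j.+2; have m0 : (0 < c * fib j.+3)%N by rewrite muln_gt0; lia.
case oj: (odd j).
  apply: unsum_near0 => //; exists (Z.of_nat (c * fib j.+2)).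
  rewrite err_mul_fib pow_m1 /= oj /= Rmult_1_l; apply: mul_pow_alpha_bounds => //.
  by case: j oj cj {f0 m0} => [|[|j]] //=; lia.
apply/unsumE => //; split=> //; rewrite Nat2Z.inj_mul.
have -> : -1 = (-1) ^ j.+1 by rewrite pow_m1 /= oj.
by apply: near_sum_fib_false; lia.
Qed.

(** Subtracting 2 adds $\alpha^3$ to the error, so now odd [j] reach the zone and even [j] go
    through [near_sum_shift]. *)
Lemma unsum_mul_fib_sub2 F c j : is_fibonacci_word F -> (4 <= j)%N ->
  (1 <= c <= 2)%N -> unsum F (c * fib j - 2).
Proof.
move=> hF; case: j => [|[|[|[|j]]]] // _ c12.
have f3 : (3 <= fib j.+4)%N by exact: (@fib_mono 4).
have m0 : (0 < c * fib j.+4 - 2)%N by nia.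
have Em : Z.of_nat (c * fib j.+4 - 2) = (Z.of_nat (c * fib j.+4) - 2)%Z by nia.
case oj: (odd j).
  apply: unsum_near0 => //; rewrite Em; exists (Z.of_nat (c * fib j.+3) - 1)%Z.
  rewrite errB err_mul_fib pow_m1 (_ : odd j.+2 = true) ?oddS ?negbK //.
  have := mul_pow_alpha_bounds c j.+1 c12.
  have E : err 2 1 = - alpha ^ 3 by rewrite alpha_pow3 /err; ring.
  rewrite E => /(_ _); have cj : (c <= j.+1)%N by case: j oj {f3 m0 Em} => //; lia.
  by move=> /(_ cj); lra.
apply/unsumE => //; split=> // /near_sum_shift; rewrite Em Z.sub_add.
rewrite Nat2Z.inj_mul; have {1}-> : 1 = (-1) ^ j.+2 by rewrite pow_m1 /= oj.
by apply: near_sum_fib_false; lia.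
Qed.

(** * Translation by the starting points of blocks *)

(** Here [y] is a position relative to [N]; $y=0$ is left out, as there the sign of the error of [N]
    decides. *)
Lemma near0_translate i y N K : (0 < i)%N -> (-1 <= y)%Z -> y <> 0%Z ->
  (y + 2 < fibZ i.+4)%Z -> Rabs (err N K) < alpha ^ i.+3 ->
  near0 (N + y) <-> (0 < y)%Z /\ near0 y.
Proof.
move=> i0 y1 y0 yF dK; have ab := alpha_bounds.
have [d1 d2] := Rabs_def2 _ _ dK.
have E k : err (N + y) (K + k) = err N K + err y k by exact: errD.
(* For $y=-1$ the fractional part is within $\alpha^4$ of $\alpha^2$, far from $(2\alpha^2,1)$. *)
have [Ey|ygt0] : y = (-1)%Z \/ (0 < y)%Z by lia.
  split; last by lia.
  case=> k; have := E (k - K)%Z; rewrite Zplus_minus => -> {E}.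
  rewrite Ey alpha_pow3; set l := (k - K)%Z.
  have a4 : alpha ^ i.+3 <= alpha ^ 4 by apply: alpha_pow_le; lia.
  move: a4; rewrite (alpha_powSS 2) alpha_pow2 alpha_pow3 [err (-1) _]/err => a4 e.
  have : (-1 < l)%Z by apply: lt_IZR; lra.
  have : (l < 0)%Z by apply: lt_IZR; lra.
  by lia.
(* [y] and [y + 2] are too small to be within [alpha ^ (i + 3)] of an integer, so
   the shift by [N] moves [y] across neither endpoint of the zone. *)
have lo k : alpha ^ i.+3 <= err y k \/ err y k <= - alpha ^ i.+3.
  case: (Rlt_le_dec (Rabs (err y k)) (alpha ^ i.+3)) => [/best_approx_abs|].
    by move/(_ ygt0); lia.
  by rewrite /Rabs; case: Rcase_abs; lra.
have hi k : alpha ^ i.+3 <= err y k - alpha ^ 3 \/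
            err y k - alpha ^ 3 <= - alpha ^ i.+3.
  have -> : err y k - alpha ^ 3 = err (y + 2) (k + 1).
    by rewrite alpha_pow3 errD /err; ring.
  case: (Rlt_le_dec (Rabs (err (y + 2) (k + 1))) (alpha ^ i.+3)).
    by move/best_approx_abs => /(_ ltac:(lia)); lia.
  by rewrite /Rabs; case: Rcase_abs; lra.
split=> [[k]|[_ [k ek]]].
  have := E (k - K)%Z; rewrite Zplus_minus => -> ek; split=> //.
  by exists (k - K)%Z; have := lo (k - K)%Z; have := hi (k - K)%Z; lra.
by exists (K + k)%Z; rewrite E; have := lo k; have := hi k; lra.
Qed.

(** The left value belongs to the first copy of $2W_i$, the right one to the second. *)
Definition block_start (i N : nat) : Prop :=
  N = (2 * fib (i + 5))%N \/ N = fib (i + 7).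

Lemma block_start_err i N : (0 < i)%N -> block_start i N ->
  exists K, Rabs (err (Z.of_nat N) K) < alpha ^ i.+3.
Proof.
move=> i0 st; have a3 := alpha_pow_gt0 i.+3.
have a4 := alpha_powS_bounds i.+3; have a5 := alpha_powS_bounds i.+4.
case: st => ->.
  exists (Z.of_nat (2 * fib (i + 4))); rewrite !addnS addn0 err_mul_fib.
  rewrite (_ : IZR (Z.of_nat 2) = 2) // pow_m1.
  by apply: Rabs_def1; case: odd; lra.
exists (fibZ (i + 6)); rewrite !addnS addn0 err_fib_abs.
have : alpha ^ i.+4.+3 <= alpha ^ i.+4 by apply: alpha_pow_le; lia.
by lra.
Qed.

(** Two parameters for all these values turn comparisons with block ends into linear arithmetic. *)
Lemma fibD7 i : exists a b, [/\ (2 <= b <= a)%N,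
  fib (i + 3) = b /\ fib (i + 4) = a, fib (i + 5) = (a + b)%N,
  fib (i + 6) = (2 * a + b)%N /\ fib (i + 7) = (3 * a + 2 * b)%N &
  fib (i + 8) = (5 * a + 3 * b)%N].
Proof.
exists (fib (i + 4)), (fib (i + 3)).
have h3 : (2 <= fib (i + 3))%N by apply: (@fib_mono 3); lia.
have h4 : (fib (i + 3) <= fib (i + 4))%N by apply: fib_mono; lia.
by rewrite !addnS addn0 !fibSS in h3 h4 *; split; lia.
Qed.

(** $F_j$ is at most $F_{i+4}$, one of the next three Fibonacci numbers, or at least $F_{i+8}$; the
    value $x=2$ is [N] itself. *)
Lemma block_start_no_mul_fib i N x j c : (0 < i)%N -> block_start i N ->
  (0 < x < fib (i + 4))%N -> x <> 2%N -> (1 <= c <= 2)%N ->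
  (N - 2 + x)%N <> (c * fib j)%N /\ (N - 2 + x).+2 <> (c * fib j)%N.
Proof.
move=> i0 st xF x2 c12.
have h3 : (3 <= fib (i + 3))%N by apply: (@fib_mono 4); lia.
have [a [b [ba [E3 E4] E5 [E6 E7] E8]]] := fibD7 i.
have Ec : c = 1%N \/ c = 2%N by lia.
have Hj : [\/ (fib j <= a)%N, fib j = (a + b)%N,
    fib j = (2 * a + b)%N \/ fib j = (3 * a + 2 * b)%N | (5 * a + 3 * b <= fib j)%N].
  have [j4|j4] := leqP j (i + 4); first by constructor 1; rewrite -E4; apply: fib_mono.
  have [j8|j8] := leqP (i + 8) j; first by constructor 4; rewrite -E8; apply: fib_mono.
  have [Ej|[Ej|Ej]] : j = (i + 5)%N \/ j = (i + 6)%N \/ j = (i + 7)%N by lia.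
  - by constructor 2; rewrite Ej.
  - by constructor 3; left; rewrite Ej.
  - by constructor 3; right; rewrite Ej.
rewrite /block_start E5 E7 in st; rewrite E4 in xF; rewrite E3 in h3.
by case: st => ->; case: Ec => ->; case: Hj => H; split; lia.
Qed.

(** [block_start_no_mul_fib] removes the sporadic unsums and [near0_translate] moves the others to
    the origin. *)
Lemma block_unsum F i N x : is_fibonacci_word F -> (0 < i)%N ->
  block_start i N -> (0 < x < fib (i + 4))%N -> x <> 2%N ->
  unsum F (N - 2 + x) <-> (2 < x)%N /\ near0 (Z.of_nat (x - 2)).
Proof.
move=> hF i0 st xF x2.
have N2 : (2 < N)%N.
  have [a [b [ba [E3 E4] E5 [E6 E7] E8]]] := fibD7 i.
  by move: st; rewrite /block_start E5 E7; lia.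
have [K dK] := block_start_err i N i0 st.
have EN : Z.of_nat (N - 2 + x) = (Z.of_nat N + (Z.of_nat x - 2))%Z by lia.
have := near0_translate i (Z.of_nat x - 2) (Z.of_nat N) K i0.
rewrite -[i.+4]addn4 -EN => tr.
have {}tr : near0 (Z.of_nat (N - 2 + x)) <->
            (0 < Z.of_nat x - 2)%Z /\ near0 (Z.of_nat x - 2).
  by apply: tr => //; lia.
split.
  case/(unsum_cases _ _ hF) => [/tr [x0 nx]|[j [c [j3 c12]]]].
    by rewrite Nat2Z.inj_sub; [split=> //|]; lia.
  by have [] := block_start_no_mul_fib i N x j c i0 st xF x2 c12; lia.
case=> x3; rewrite Nat2Z.inj_sub; last by lia.
move=> nx; apply: unsum_near0 => //; first by lia.
by apply/tr; split=> //; lia.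
Qed.

Local Close Scope R_scope.

(** * Gaps *)

(** Certifies [s] as consecutive gaps of [P] from [p] on without an enumeration, so that stretches
    can be checked separately and joined. *)
Fixpoint walk (P : nat -> Prop) (p : nat) (s : seq nat) : Prop :=
  if s is g :: s' then
    [/\ 0 < g, P (p + g), forall m, p < m < p + g -> ~ P m & walk P (p + g) s']
  else True.

Lemma walk_cat P p s t :
  walk P p s -> walk P (p + sumn s) t -> walk P p (s ++ t).
Proof.
elim: s p => [|g s IHs] p /=; first by rewrite addn0.
by case=> g0 Pg nP ws; rewrite addnA => wt; split=> //; exact: IHs.
Qed.

Lemma sumn_mkseqS g k : sumn (mkseq g k.+1) = sumn (mkseq g k) + g k.
Proof. by rewrite mkseqS sumn_rcons. Qed.

Lemma walk_mkseq P p g K :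
  (forall k, k < K -> [/\ 0 < g k, P (p + sumn (mkseq g k.+1)) &
     forall m, p + sumn (mkseq g k) < m < p + sumn (mkseq g k.+1) -> ~ P m]) ->
  walk P p (mkseq g K).
Proof.
elim: K => // K IHK H; rewrite mkseqS -cats1; apply: walk_cat.
  by apply: IHK => k lt_kK; apply: H; exact: ltnW.
have [gK PK nP] := H K (ltnSn K).
by rewrite sumn_mkseqS addnA in PK nP; split.
Qed.

Lemma increasing_leq_mono (u : nat -> nat) :
  (forall n, u n < u n.+1) -> {mono u : m n / m <= n}.
Proof. by move=> inc; apply: leq_mono; exact: (homo_ltn ltn_trans inc). Qed.

Lemma walk_gaps P u n p s : increasing_enumeration P u -> u n = p ->
  walk P p s -> forall j, j < size s -> gaps u (n + j) = nth 0 s j.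
Proof.
case=> inc Pu; elim: s n p => //= g s IHs n p un [g0 Pg nP ws].
have un1 : u n.+1 = p + g.
  have [k uk] := (Pu (p + g)).1 Pg; apply/eqP; rewrite eqn_leq; apply/andP; split.
    by rewrite -uk (increasing_leq_mono _ inc) ltnNge
      -(increasing_leq_mono _ inc) uk un; lia.
  rewrite leqNgt; apply/negP => lt; apply: (nP (u n.+1)).
    by rewrite lt andbT -un inc.
  by apply/Pu; exists n.+1.
case=> [_|j lt_j] /=; first by rewrite addn0 /gaps un1 un addKn.
by rewrite -addSnnS; exact: (IHs _ _ un1).
Qed.

(** * Existence of the enumeration *)

Lemma enumeration_exists (P : pred nat) :
  (forall n, exists m, (n <= m) && P m) -> exists u, increasing_enumeration P u.
Proof.
move=> inf; pose next n := ex_minn (inf n).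
have nextP n : [/\ n <= next n, P (next n) & forall m, n <= m -> P m -> next n <= m].
  rewrite /next; case: ex_minnP => m /andP[le_nm Pm] min_m; split=> // k nk Pk.
  by apply: min_m; rewrite nk.
pose u := fix u n := if n is n'.+1 then next (u n').+1 else next 0.
have inc n : u n < u n.+1 by have [] := nextP (u n).+1.
exists u; split=> // m; split=> [Pm|[[|n] <-]]; last 2 first.
- by have [] := nextP 0.
- by have [] := nextP (u n).+1.
have ex : exists n, m <= u n.
  by exists m; elim: m {Pm} => // m IHm; exact: leq_ltn_trans (inc m).
case: (ex_minnP ex) => n le_mn min_n; exists n; apply/eqP; rewrite eqn_leq le_mn.
rewrite andbT; case: n le_mn min_n => [|n] le_mn min_n.
  by have [_ _] := nextP 0; apply.
have [_ _] := nextP (u n).+1; apply=> //; rewrite ltnNge; apply/negP => le_mun.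
by have := min_n _ le_mun; rewrite ltnn.
Qed.

Definition unsumb (F : nat -> letter) (m : nat) : bool :=
  (0 < m) && ~~ [exists x : 'I_m, [&& 0 < x, ~~ is_La (F x.-1),
                                      ~~ is_La (F (m - x).-1) & x != m - x :> nat]].

Lemma unsumbP F m : reflect (unsum F m) (unsumb F m).
Proof.
have Lb_eq n : F n = Lb <-> ~~ is_La (F n) by case: (F n).
apply: (iffP andP) => -[m0 ns]; split=> //.
  case=> x [y [[x0 Fx] [y0 Fy] nxy Em]]; case/negP: ns; apply/existsP.
  have lt_xm : x < m by lia.
  exists (Ordinal lt_xm) => /=; rewrite x0 Em addKn /=.
  by apply/and3P; split; [exact/Lb_eq|exact/Lb_eq|apply/eqP].
apply/negP => /existsP[x /and4P[x0 /Lb_eq Fx /Lb_eq Fy /eqP nxy]]; apply: ns.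
by exists x, (m - x); have := ltn_ord x; split=> //; try split=> //; lia.
Qed.

Lemma unsum_enumeration F : is_fibonacci_word F ->
  exists u, increasing_enumeration (unsum F) u.
Proof.
move=> hF; have [n|u [inc uP]] := @enumeration_exists (unsumb F).
  (* Fibonacci numbers serve as arbitrarily large unsums. *)
  exists (fib n.+3); have := fib_ge n.+3; rewrite !ltnS => /ltnW/ltnW le_n.
  rewrite le_n; apply/unsumbP; rewrite -[fib _]mul1n.
  by apply: unsum_mul_fib => //; left.
by exists u; split=> // m; rewrite -uP; split=> /unsumbP.
Qed.

(** * The words $W_i$ *)

(** In $W_1$, of length 1, the two outer letters 3 coincide, hence the separate case. *)
Definition block (F : nat -> letter) (i : nat) : seq nat :=
  if i <= 1 then [:: 3] else
  3 :: rcons (mkseq (recode \o F) (fib i.+1 - 2)) 3.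

Lemma sumn_recode F k :
  sumn (mkseq (recode \o F) k) = 3 * k + 2 * count_La F k.
Proof.
elim: k => // k IHk; rewrite sumn_mkseqS IHk count_LaS /=.
by case: (F k) => /=; lia.
Qed.

(** The count is $\lfloor(F_{i+1}-1)\alpha\rfloor$, and $(F_{i+1}-1)\alpha$ is within $\alpha^3$ of
    $F_i-\alpha$. *)
Lemma count_La_fib F i : is_fibonacci_word F -> 1 < i ->
  count_La F (fib i.+1 - 2) = fib i - 1.
Proof.
move=> hF; case: i => [|[|i]] // _.
have f3 : 2 <= fib i.+3 by exact: (@fib_mono 3).
have f2 := fib_gt0 i.+1.
have := count_La_err _ (fib i.+3 - 2) hF.
have -> : Z.of_nat (fib i.+3 - 2).+1 = (fibZ i.+3 - 1)%Z by lia.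
set c := count_La _ _ => ec.
suff : (Z.of_nat c - (fibZ i.+2 - 1) = 0)%Z by lia.
apply: IZR_lt1.
have := errB (fibZ i.+3) 1 (fibZ i.+2) 1; rewrite err_fib.
have := errk (fibZ i.+3 - 1) (fibZ i.+2 - 1) (Z.of_nat c).
have ab := alpha_bounds; have a3 := alpha_pow_gt0 i.+3.
have : (alpha ^ i.+3 <= alpha ^ 3)%real by exact: alpha_pow_le.
by rewrite alpha_pow3 pow_m1 (errE 1); case: odd; lra.
Qed.

Lemma fibD4 i : fib (i + 4) = 3 * fib i.+1 + 2 * fib i.
Proof. by rewrite !addnS addn0 !fibSS; lia. Qed.

Lemma sumn_block F i : is_fibonacci_word F -> 0 < i ->
  sumn (block F i) + 2 = fib (i + 4).
Proof.
move=> hF; rewrite /block; case: (leqP i 1) => [|i1 _]; first by case: i => [|[]].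
rewrite /= sumn_rcons sumn_recode count_La_fib // fibD4.
have : 2 <= fib i.+1 by exact: (@fib_mono 3).
have : 1 <= fib i by exact: (@fib_mono 2).
by lia.
Qed.

Lemma size_block F i : 0 < i -> size (block F i) = fib i.+1.
Proof.
rewrite /block; case: (leqP i 1) => [|i1 _]; first by case: i => [|[]].
have : 2 <= fib i.+1 by exact: (@fib_mono 3).
by rewrite /= size_rcons size_mkseq; lia.
Qed.

(** With $x=k+1$, the map $x\mapsto F_{i+2}-1-x$ reflects the arc of b up to a shift by
    $\alpha^{i+2}$; [best_approx_abs] for $x$ and $x+1$ keeps the point further than that from both
    endpoints. *)
Lemma fib_word_sym F i k : is_fibonacci_word F -> k < fib i.+2 - 2 ->
  F k = Lb -> F (fib i.+2 - 3 - k) = Lb.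
Proof.
move=> hF lt_k /(fib_word_Lb _ _ hF)[q eq]; apply/(fib_word_Lb _ _ hF).
have Eb : Z.of_nat (fib i.+2 - 3 - k).+1 = (fibZ i.+2 - 1 - Z.of_nat k.+1)%Z by lia.
rewrite Eb; exists (fibZ i.+1 - 1 - q)%Z.
rewrite !errB err_fib (errE 1); move: eq; set e := err _ q => eq.
have ai := alpha_pow_gt0 i.+1; have ai2 := alpha_powS_bounds i.+1.
have lo : (Rabs e >= alpha ^ i.+1)%real.
  case: (Rlt_le_dec (Rabs e) (alpha ^ i.+1)) => [/best_approx_abs|]; last by lra.
  by lia.
have hi : (Rabs (e + alpha ^ 2) >= alpha ^ i.+1)%real.
  have -> : (e + alpha ^ 2)%real = err (Z.of_nat k.+1 + 1) (q + 1).
    by rewrite errD alpha_pow2 (errE 1) /e; ring.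
  case: (Rlt_le_dec (Rabs (err (Z.of_nat k.+1 + 1) (q + 1))) (alpha ^ i.+1)).
    by move/best_approx_abs; lia.
  by lra.
move: lo hi; rewrite alpha_pow2 in eq *; rewrite /Rabs.
by rewrite pow_m1; case: Rcase_abs; case: Rcase_abs; case: odd; lra.
Qed.

Lemma rev_block F i : is_fibonacci_word F -> 0 < i -> rev (block F i) = block F i.
Proof.
move=> hF i0; rewrite /block; case: (leqP i 1) => // i1.
rewrite rev_cons rev_rcons rcons_cons; congr (_ :: rcons _ _).
apply: (@eq_from_nth _ 0) => [|k]; rewrite size_rev size_mkseq // => lt_k.
rewrite nth_rev ?size_mkseq // !nth_mkseq //=; last by lia.
case: i i0 i1 lt_k => // i _ _ lt_k.
have -> : fib i.+2 - 2 - k.+1 = fib i.+2 - 3 - k by lia.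
congr recode; set k' := fib i.+2 - 3 - k.
have lt_k' : k' < fib i.+2 - 2 by rewrite /k'; lia.
have sym := @fib_word_sym F i k hF lt_k; have sym' := @fib_word_sym F i k' hF lt_k'.
have Ek : fib i.+2 - 3 - k' = k by rewrite /k'; lia.
rewrite Ek in sym'; rewrite -/k' in sym.
by case E: (F k) sym sym' => sym sym'; case E': (F k') sym sym' => //= sym sym';
   [have := sym' erefl | have := sym erefl].
Qed.

(** * The gaps as doubled blocks *)

Lemma block_walk F i N : is_fibonacci_word F -> 0 < i -> block_start i N ->
  walk (unsum F) (N - 2) (2 :: block F i).
Proof.
move=> hF i0 st.
have [a [b [ba [E3 E4] E5 [E6 E7] E8]]] := fibD7 i.
have N2 : 2 < N by move: st; rewrite /block_start E5 E7; lia.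
have UN : unsum F N.
  case: st => ->; first by apply: unsum_mul_fib => //; lia.
  by rewrite -[fib _]mul1n; apply: unsum_mul_fib => //; lia.
(* A block ends where the next one starts: at $F_{i+7}-2$ after a first copy, at $2F_{i+6}-2$ after
   a second. *)
have Uend : unsum F (N - 2 + fib (i + 4)).
  case: st => ->.
    have -> : 2 * fib (i + 5) - 2 + fib (i + 4) = 1 * fib (i + 7) - 2 by lia.
    by apply: unsum_mul_fib_sub2 => //; lia.
  have -> : fib (i + 7) - 2 + fib (i + 4) = 2 * fib (i + 6) - 2 by lia.
  by apply: unsum_mul_fib_sub2 => //; lia.
have inner m : N - 2 < m < N - 2 + fib (i + 4) -> m <> N -> unsum F m <->
    exists k, m = N + (3 + 3 * k + 2 * count_La F k).
  move=> mN mneN; have [x Em] : exists x, m = N - 2 + x by exists (m - (N - 2)); lia.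
  rewrite Em (block_unsum F i N x) //; try lia.
  split=> [[x2 /(near0_fib_word F _ hF)]|[k Ek]].
    by case=> [|k Ek]; [lia|exists k; lia].
  split; first by lia.
  by apply/(near0_fib_word F _ hF); [lia|exists k; lia].
have out m : N - 2 < m < N + 3 -> m < N - 2 + fib (i + 4) -> m <> N -> ~ unsum F m.
  by move=> m1 m2 mN /inner -/(_ ltac:(lia) mN)[k]; lia.
have F3 : 5 <= fib (i + 4) by apply: (@fib_mono 5); lia.
split=> //; rewrite ?subnK //; try lia.
  by move=> m mN; apply: out; lia.
have := sumn_block F i hF i0; rewrite /block; case: (ltnP 1 i) => [i1|i1] sumW.
  set K := fib i.+1 - 2 in sumW *.
  (* The 8 consists of the leading 2 and the two outer letters 3. *)
  have sumK : sumn (mkseq (recode \o F) K) + 8 = fib (i + 4).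
    by move: sumW; rewrite /= sumn_rcons; lia.
  have mono k l : k <= l -> count_La F k <= count_La F l.
    apply: (homo_leq leqnn leq_trans) => {}k; rewrite count_LaS; exact: leq_addr.
  split=> //.
  - have [c0 k0] : count_La F 0 = 0 /\ 8 <= fib (i + 4).
      by split=> //; apply: (@fib_mono 6); lia.
    by apply/inner; [lia|lia|exists 0; rewrite c0; lia].
  - by move=> m mN; apply: out; lia.
  rewrite -cats1; apply: walk_cat.
    apply: walk_mkseq => k lt_k.
    have sum_le l : l <= K -> sumn (mkseq (recode \o F) l) + 8 <= fib (i + 4).
      by move=> le_l; have := mono _ _ le_l; rewrite -sumK !sumn_recode; lia.
    have sk := sum_le k (ltnW lt_k); have sk1 := sum_le _ lt_k.
    split; first by rewrite /=; case: (F k).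
      by apply/inner; [lia|lia|exists k.+1; rewrite sumn_recode; lia].
    (* An unsum in between would be a partial sum of index strictly between [k] and [k.+1]. *)
    move=> m mk /inner => /(_ ltac:(lia) ltac:(lia))[l Em].
    move: mk; rewrite Em !sumn_recode => mk.
    have [lk|lk] := leqP l k; first by have := mono _ _ lk; lia.
    by have := mono _ _ lk; lia.
  split=> //.
  - by have -> : N + 3 + sumn (mkseq (recode \o F) K) + 3 = N - 2 + fib (i + 4) by lia.
  move=> m mk /inner => /(_ ltac:(lia) ltac:(lia))[l Em].
  move: mk sumK; rewrite Em !sumn_recode => mk sumK.
  have [lk|lk] := leqP l K; first by have := mono _ _ lk; lia.
  by have := mono _ _ (ltnW lk); lia.
have Ei : fib (i + 4) = 5 by have -> : i = 1 by lia.
split=> //; first by have -> : N + 3 = N - 2 + fib (i + 4) by lia.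
by move=> m mN; apply: out; lia.
Qed.

Lemma doubled_blocksS W k :
  doubled_blocks W k.+1 =
  doubled_blocks W k ++ (2 :: W k.+1) ++ (2 :: W k.+1).
Proof.
by rewrite /doubled_blocks -[in LHS](addn1 k) iotaD map_cat flatten_cat /= cats0 add1n.
Qed.

(** Starting from $14=2F_6-2$, the first [k] pairs end at $2F_{k+6}-2$, where pair [k.+1] starts. *)
Lemma sumn_doubled_blocks F k : is_fibonacci_word F ->
  16 + sumn (doubled_blocks (block F) k) = 2 * fib (k + 6).
Proof.
move=> hF; elim: k => // k IHk; rewrite doubled_blocksS !sumn_cat [sumn (2 :: _)]/=.
have := sumn_block F k.+1 hF isT.
have [a [b [ba [E3 E4] E5 [E6 E7] E8]]] := fibD7 k.
rewrite (addSnnS k 4) E5 (addSnnS k 6) E7; rewrite E6 in IHk; lia.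
Qed.

Lemma doubled_blocks_walk F k : is_fibonacci_word F ->
  walk (unsum F) 14 (doubled_blocks (block F) k).
Proof.
move=> hF; elim: k => // k IHk; rewrite doubled_blocksS.
have S := sumn_doubled_blocks F k hF; have Sb := sumn_block F k.+1 hF isT.
have [a [b [ba [E3 E4] E5 [E6 E7] E8]]] := fibD7 k.
apply: walk_cat => //; set p := 14 + _.
have -> : p = 2 * fib (k.+1 + 5) - 2 by rewrite (addSnnS k 5); lia.
apply: walk_cat; first by apply: block_walk => //; left.
have -> : 2 * fib (k.+1 + 5) - 2 + sumn (2 :: block F k.+1) = fib (k.+1 + 7) - 2.
  rewrite [sumn _]/=; move: Sb.
  by rewrite (addSnnS k 4) (addSnnS k 5) (addSnnS k 7) E5 E6 E8; lia.
by apply: block_walk => //; right.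
Qed.

Lemma unsum1 F : is_fibonacci_word F -> unsum F 1.
Proof. by move=> hF; exact: (@unsum_mul_fib_sub2 F 1 4). Qed.

(** The letters are those of the explicit [fibonacci_word], so that they can be computed. *)
Lemma not_unsum_add F x y : is_fibonacci_word F -> x <> y ->
  fibonacci_word x = Lb -> fibonacci_word y = Lb -> ~ unsum F (x.+1 + y.+1).
Proof.
move=> hF nxy Fx Fy [_]; apply; exists x.+1, y.+1; have E := fibonacci_word_uniq hF.
by split=> //; [split=> //=; rewrite E|split=> //=; rewrite E|case].
Qed.

(** Every unsum up to 14 has the form $cF_j$ or $cF_j-2$; the skipped 7, 9, 12 are $2+5$, $2+7$,
    $5+7$. *)
Lemma initial_walk F : is_fibonacci_word F ->
  walk (unsum F) 1 [:: 1; 1; 1; 1; 1; 2; 2; 1; 2; 1].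
Proof.
move=> hF.
have U c j : 3 <= j -> 1 <= c <= 2 -> c = 1 \/ j <> 4 -> unsum F (c * fib j).
  by move=> *; exact: unsum_mul_fib.
have V c j : 4 <= j -> 1 <= c <= 2 -> unsum F (c * fib j - 2).
  by move=> *; exact: unsum_mul_fib_sub2.
have N7 : ~ unsum F 7 by apply: (@not_unsum_add F 1 4).
have N9 : ~ unsum F 9 by apply: (@not_unsum_add F 1 6).
have N12 : ~ unsum F 12 by apply: (@not_unsum_add F 4 6).
rewrite /=; split=> //; [by apply: (U 1 3); lia|lia|].
split=> //; [by apply: (U 1 4); lia|lia|].
split=> //; [by apply: (U 2 3); lia|lia|].
split=> //; [by apply: (U 1 5); lia|lia|].
split=> //; [by apply: (V 1 6); lia|lia|].
split=> //; [by apply: (U 1 6); lia|move=> m ?|].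
  by have -> : m = 7 by lia.
split=> //; [by apply: (U 2 5); lia|move=> m ?|].
  by have -> : m = 9 by lia.
split=> //; [by apply: (V 1 7); lia|lia|].
split=> //; [by apply: (U 1 7); lia|move=> m ?|].
  by have -> : m = 12 by lia.
by split=> //; [apply: (V 2 6); lia|lia].
Qed.

Lemma unsum_enumeration0 F u : is_fibonacci_word F ->
  increasing_enumeration (unsum F) u -> u 0 = 1.
Proof.
move=> hF [inc uP]; have [n un] := (uP 1).1 (unsum1 F hF).
have [u0 _] : unsum F (u 0) by apply/uP; exists 0.
have : u 0 <= u n by rewrite (increasing_leq_mono _ inc).
by lia.
Qed.

Lemma block_subset F i : {subset block F i <= [:: 3; 5]}.
Proof.
rewrite /block => x; case: ifP => _; first by rewrite !inE => ->.
rewrite inE mem_rcons inE => /or3P[/eqP->|/eqP->|/mapP[k _ ->]] //=.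
by case: (F k).
Qed.

(** Only the closing 3 of a block may differ from the limit word. *)
Lemma nth_block F n k : k + 1 < fib n.+1 -> 1 < n ->
  nth 0 (block F n) k = cons_word 3 (recode \o F) k.
Proof.
move=> lt_k n1; rewrite /block leqNgt n1; case: k lt_k => //= k lt_k.
by rewrite nth_rcons size_mkseq ifT ?nth_mkseq //; lia.
Qed.

Lemma take_block F n m : 1 < n -> m < fib n.+1 ->
  take m (block F n) = mkseq (cons_word 3 (recode \o F)) m.
Proof.
move=> n1 lt_m; have sz := size_block F n (ltnW n1).
apply: (@eq_from_nth _ 0) => [|k]; rewrite size_takel ?size_mkseq; try lia.
by move=> lt_k; rewrite nth_take // nth_mkseq // nth_block //; lia.
Qed.

Theorem mainTheorem1 (F : nat -> letter) (hF : is_fibonacci_word F) :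
  (exists u : nat -> nat, increasing_enumeration (unsum F) u) /\
  forall u : nat -> nat, increasing_enumeration (unsum F) u ->
  exists W : nat -> seq nat,
    (forall i, 1 <= i -> {subset W i <= [:: 3; 5]}) /\
    W 1 = [:: 3] /\ W 2 = [:: 3; 3] /\ W 3 = [:: 3; 5; 3] /\
    (forall k, prefix_of
       ([:: 1; 1; 1; 1; 1; 2; 2; 1; 2; 1] ++ doubled_blocks W k) (gaps u)) /\
    (* (i) *)
    (forall i, 1 <= i -> rev (W i) = W i /\ size (W i) = fib i.+1) /\
    (* (ii) *)
    (forall i, 1 <= i -> sumn (W i) + 2 = fib (i + 4)) /\
    (* (iii): [uphalf m] is the ceiling of m / 2 *)
    (forall n, 3 <= n ->
       take (uphalf (size (W n.+1))) (W n.+1) =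
       take (uphalf (size (W n.+1))) (W n)) /\
    (* (iv) *)
    words_converge 0 W (cons_word 3 (recode \o F)).
Proof.
split; first exact: unsum_enumeration.
move=> u hu; exists (block F); have [F0 _] := hF.
split; first by move=> i _; exact: block_subset.
split=> //; split=> //; split; first by rewrite /block /= F0.
split.
  move=> k; apply: (@eq_from_nth _ 0) => [|j lt_j]; first by rewrite size_mkseq.
  rewrite nth_mkseq // -[in RHS](add0n j).
  symmetry; apply: (walk_gaps _ _ _ _ _ hu (unsum_enumeration0 F u hF hu)) => //.
  by apply: walk_cat; [exact: initial_walk|exact: doubled_blocks_walk].
split; first by move=> i i0; split; [exact: rev_block|exact: size_block].
split; first by move=> i i0; exact: sumn_block.
split.
  move=> n n3; rewrite size_block //.
  (* For $n=3$ the common prefix is all of $W_3$, closing 3 included, so [take_block] does not cover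
     it. *)
  have [n4|n4] := leqP 4 n; last first.
    have -> : n = 3 by lia.
    have E : mkseq F 3 = [:: La; Lb; La].
      by rewrite (eq_mkseq (fibonacci_word_uniq hF)).
    by rewrite /block /=; case: E => -> -> _.
  (* $F_{n+1}-F_n=F_{n-1}\ge2$ makes $\lceil F_{n+2}/2\rceil$ less than $F_{n+1}$. *)
  have f : 2 <= fib n.-1 by apply: (@fib_mono 3); lia.
  case: n n3 n4 f => [|[|n]] // n3 n4 f.
  by rewrite !take_block //; move: f; rewrite [_.-1]/= !fibSS; lia.
move=> k; exists (k + 3) => n le_n; have := fib_ge n.+1 => fn.
by rewrite size_block ?nth_block; try split; lia.
Qed.
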